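(* Let $k$ be a commutative field and $\mathcal{A}$ an essentially small additive category. The following assertions are equivalent: 1. for every finitely generated functor $F$ of $\mathcal{F}(\mathcal{A};k)$, there exists $d\in\mathbb{N}$ such that $F\in\mathcal{F}_d(\mathcal{A};k)$; 2. the abelian category $\mathbf{Rep}(\mathcal{A})$ is locally finite.
   Context: $\mathbf{Rep}(\mathcal{A})$ is the abelian category of additive functors $\mathcal{A}\to\mathbf{Ab}$; $\mathcal{F}(\mathcal{A};k)$ is the abelian category of all (not necessarily additive) functors from $\mathcal{A}$ to $k$-vector spaces. Exactness is pointwise in both. A functor of $\mathcal{F}(\mathcal{A};k)$ is finitely generated iff it is a quotient of a finite direct sum of functors $k[\mathcal{A}(a_i,-)]$, where $k[E]$ is the $k$-vector space with basis the set $E$. A Grothendieck category is locally finite if it is generated by its objects of finite length. For $F\in\mathcal{F}(\mathcal{A};k)$ and $x\in\mathrm{Ob}\,\mathcal{A}$: $\tau_x(F)(a)=F(x\oplus a)$. The group $\mathcal{A}(x,a)$ acts on $F(x\oplus a)$ through $u\mapsto F\begin{pmatrix}\mathrm{Id}_x&0\\ u&\mathrm{Id}_a\end{pmatrix}$, and $\bar\tau_x(F)(a):=F(x\oplus a)_{\mathcal{A}(x,a)}$ (coinvariants), a quotient functor of $\tau_x(F)$. The canonical inclusions $a\to x\oplus a$ induce a natural morphism $F\to\bar\tau_x(F)$, whose cokernel is $\bar\delta_x(F)$. For $d\ge -1$, $\mathcal{F}_d(\mathcal{A};k)$ is the full subcategory of functors $F$ with $\bar\delta_{a_0}\cdots\bar\delta_{a_d}\tau_x(F)=0$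 for all objects $a_0,\dots,a_d,x$ of $\mathcal{A}$. *)

(* Defs.v *)
From HB Require Import structures.
From mathcomp Require Import all_boot all_algebra ring_quotient.
From mathcomp Require Import boolp.
From mathcomp.multinomials Require Import freeg.

Set Implicit Arguments.
Unset Strict Implicit.
Unset Printing Implicit Defensive.

Import GRing.Theory.
Local Open Scope ring_scope.
Local Open Scope quotient_scope.

(* [submodClosed] alone does not carry the closure under opposites that the
   library quotient [Quotient.quot] of a [zmodType] needs; [submod_pred] does. *)
Section QuotientLmodule.
Variables (R : pzRingType) (V : lmodType R).

Definition submod_pred (W : submodClosed V) : {pred V} := W.

Fact submod_pred_closed W : zmod_closed (submod_pred W).
Proof. exact/GRing.submod_closedB/GRing.submodClosedP. Qed.

HB.instance Definition _ W :=
  GRing.isZmodClosed.Build V (submod_pred W) (submod_pred_closed W).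

Variable W : submodClosed V.

Definition quotmod := Quotient.quot (submod_pred W).

HB.instance Definition _ := GRing.Zmodule.on quotmod.
HB.instance Definition _ := EqQuotient.on quotmod.

Definition qproj (x : V) : quotmod := \pi_(Quotient.quot (submod_pred W)) x.

Fact qproj_is_zmod_morphism : zmod_morphism qproj.
Proof. exact: raddfB. Qed.

HB.instance Definition _ :=
  GRing.isZmodMorphism.Build V quotmod qproj qproj_is_zmod_morphism.

Lemma qproj_eq0 x : (qproj x == 0) = (x \in W).
Proof.
have /esym := Quotient.idealrBE (submod_pred W) x 0; rewrite subr0 => <-.
by congr (_ == _); rewrite [RHS]raddf0.
Qed.

Lemma qproj_repr (x : quotmod) : qproj (repr x) = x.
Proof. exact: reprK. Qed.

Definition quot_scale (c : R) (x : quotmod) : quotmod := qproj (c *: repr x).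

Lemma qproj_scale c (x : V) : qproj (c *: x) = quot_scale c (qproj x).
Proof.
apply/eqP; rewrite -subr_eq0 -raddfB qproj_eq0 -scalerBr; apply: rpredZ.
by rewrite -qproj_eq0 raddfB /= qproj_repr subrr.
Qed.

Fact quot_scaleA a b x : quot_scale a (quot_scale b x) = quot_scale (a * b) x.
Proof. by rewrite -[x]qproj_repr -!qproj_scale scalerA. Qed.

Fact quot_scale1 : left_id 1 quot_scale.
Proof. by move=> x; rewrite -[x]qproj_repr -qproj_scale scale1r. Qed.

Fact quot_scaleDr : right_distributive quot_scale +%R.
Proof.
move=> a x y; rewrite -[x]qproj_repr -[y]qproj_repr.
by rewrite -raddfD -!qproj_scale scalerDr raddfD.
Qed.

Fact quot_scaleDl x : {morph quot_scale^~ x : a b / a + b}.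
Proof. by move=> a b; rewrite -[x]qproj_repr -!qproj_scale scalerDl raddfD. Qed.

HB.instance Definition _ := GRing.Zmodule_isLmodule.Build R quotmod
  quot_scaleA quot_scale1 quot_scaleDr quot_scaleDl.

Fact qproj_is_scalable : scalable qproj.
Proof. exact: qproj_scale. Qed.

HB.instance Definition _ :=
  GRing.isScalable.Build R V quotmod *:%R qproj qproj_is_scalable.

End QuotientLmodule.

Section QuotientMap.
Variables (R : pzRingType) (V V' : lmodType R) (W : submodClosed V).
Variables (W' : submodClosed V') (f : {linear V -> V'}).

Definition qmap of {in W, forall x, f x \in W'} :=
  fun x : quotmod W => qproj W' (f (repr x)).

Hypothesis fW : {in W, forall x, f x \in W'}.

Lemma qmap_proj x : qmap fW (qproj W x) = qproj W' (f x).
Proof.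
apply/eqP; rewrite -subr_eq0 -raddfB qproj_eq0 -raddfB.
by apply: fW; rewrite -qproj_eq0 raddfB /= qproj_repr subrr.
Qed.

Lemma qmap_is_linear : linear (qmap fW).
Proof.
move=> c x y; rewrite -[x]qproj_repr -[y]qproj_repr -linearP !qmap_proj.
by rewrite !linearP.
Qed.

HB.instance Definition _ := GRing.isLinear.Build R (quotmod W) (quotmod W') _
  (qmap fW) qmap_is_linear.

End QuotientMap.

Section Span.
Variables (R : pzRingType) (V : lmodType R).

Inductive spanned (P : V -> Prop) : V -> Prop :=
| spanned0 : spanned P 0
| spannedP c u v : P u -> spanned P v -> spanned P (c *: u + v).

Definition spanp (P : V -> Prop) : {pred V} := fun v => `[< spanned P v >].

Lemma spanp_submod P : GRing.submod_closed (spanp P).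
Proof.
split=> [|c u v /asboolP Pu /asboolP Pv]; apply/asboolP; first exact: spanned0.
elim: Pu => [|a x y Px _ IH]; first by rewrite scaler0 add0r.
by rewrite scalerDr scalerA -addrA; apply: spannedP.
Qed.

HB.instance Definition _ P :=
  GRing.isSubmodClosed.Build R V (spanp P) (spanp_submod P).

End Span.

Section Image.
Variables (R : pzRingType) (U V : lmodType R) (f : {linear U -> V}).

Definition imagep : {pred V} := fun v => `[< exists u, f u = v >].

Lemma imagep_submod : GRing.submod_closed imagep.
Proof.
split=> [|c _ _ /asboolP[u <-] /asboolP[v <-]]; apply/asboolP.
  by exists 0; rewrite raddf0.
by exists (c *: u + v); rewrite linearP.
Qed.

HB.instance Definition _ :=
  GRing.isSubmodClosed.Build R V imagep imagep_submod.

End Image.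

(* Carriers of [choiceType]s (hence of [zmodType]s and [lmodType]s) play the
   role of sets; the objects live one universe higher, so that they may form a
   proper class and essential smallness is an actual condition.  Classically
   every type carries a [choiceType] structure. *)
Record additiveCategory := AdditiveCategory {
  obj :> Type@{Choice.type.u0};
  hom : obj -> obj -> zmodType;
  idm : forall a, hom a a;
  mcomp : forall a b c, hom b c -> hom a b -> hom a c;
  mcompA : forall a b c d (h : hom c d) (g : hom b c) (f : hom a b),
    mcomp h (mcomp g f) = mcomp (mcomp h g) f;
  mcomp1m : forall a b (f : hom a b), mcomp (idm b) f = f;
  mcompm1 : forall a b (f : hom a b), mcomp f (idm a) = f;
  mcompDl : forall a b c (g g' : hom b c) (f : hom a b),
    mcomp (g + g') f = mcomp g f + mcomp g' f;
  mcompDr : forall a b c (g : hom b c) (f f' : hom a b),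
    mcomp g (f + f') = mcomp g f + mcomp g f';
  zero_obj : obj;
  from_zero : forall a (f : hom zero_obj a), f = 0;
  to_zero : forall a (f : hom a zero_obj), f = 0;
  dsum : obj -> obj -> obj;
  injl : forall a b, hom a (dsum a b);
  injr : forall a b, hom b (dsum a b);
  prl : forall a b, hom (dsum a b) a;
  prr : forall a b, hom (dsum a b) b;
  prl_injl : forall a b, mcomp (prl a b) (injl a b) = idm a;
  prr_injr : forall a b, mcomp (prr a b) (injr a b) = idm b;
  prl_injr : forall a b, mcomp (prl a b) (injr a b) = 0;
  prr_injl : forall a b, mcomp (prr a b) (injl a b) = 0;
  dsumE : forall a b,
    mcomp (injl a b) (prl a b) + mcomp (injr a b) (prr a b) = idm (dsum a b)
}.

Arguments hom {A} : rename.
Arguments idm {A} a : rename.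
Arguments mcomp {A} [a b c] : rename.
Arguments dsum {A} : rename.
Arguments injl {A} : rename.
Arguments injr {A} : rename.
Arguments prl {A} : rename.
Arguments prr {A} : rename.

Notation "a ⊕ b" := (dsum a b) (at level 50, left associativity).
Notation "g ∘ f" := (mcomp g f) (at level 40, left associativity).

Definition isomorphic (A : additiveCategory) (a b : A) : Prop :=
  exists (f : hom a b) (g : hom b a), g ∘ f = idm a /\ f ∘ g = idm b.

Definition essentially_small (A : additiveCategory) : Prop :=
  exists (I : choiceType) (t : I -> A), forall a, exists i, isomorphic a (t i).

Section AdditiveTheory.
Variable A : additiveCategory.
Implicit Types a b c x y : A.

Lemma mcomp0m a b c (f : hom a b) : (0 : hom b c) ∘ f = 0.
Proof. by apply: (addrI (0 ∘ f)); rewrite -mcompDl !addr0. Qed.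

Lemma mcompm0 a b c (g : hom b c) : g ∘ (0 : hom a b) = 0.
Proof. by apply: (addrI (g ∘ 0)); rewrite -mcompDr !addr0. Qed.

(* [Id_x ⊕ f] *)
Definition idsum x a b (f : hom a b) : hom (x ⊕ a) (x ⊕ b) :=
  injl x b ∘ prl x a + injr x b ∘ f ∘ prr x a.

(* the matrix with rows [(Id_x, 0)] and [(u, Id_a)] *)
Definition transvection x a (u : hom x a) : hom (x ⊕ a) (x ⊕ a) :=
  injl x a ∘ prl x a + injr x a ∘ u ∘ prl x a + injr x a ∘ prr x a.

Lemma idsum1 x a : idsum x (idm a) = idm (x ⊕ a).
Proof. by rewrite /idsum mcompm1 dsumE. Qed.

Lemma prl_idsum x a b (f : hom a b) : prl x b ∘ idsum x f = prl x a.
Proof.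
by rewrite /idsum mcompDr !mcompA prl_injl prl_injr mcomp1m !mcomp0m addr0.
Qed.

Lemma prr_idsum x a b (f : hom a b) : prr x b ∘ idsum x f = f ∘ prr x a.
Proof.
by rewrite /idsum mcompDr !mcompA prr_injl prr_injr mcomp1m !mcomp0m add0r.
Qed.

Lemma idsumM x a b c (g : hom b c) (f : hom a b) :
  idsum x (g ∘ f) = idsum x g ∘ idsum x f.
Proof.
rewrite [idsum x g]/idsum mcompDl -!mcompA prl_idsum prr_idsum.
by rewrite /idsum -!mcompA.
Qed.

Lemma idsum_injr x a b (f : hom a b) : idsum x f ∘ injr x a = injr x b ∘ f.
Proof. by rewrite /idsum mcompDl -!mcompA prl_injr prr_injr mcompm1 mcompm0 add0r. Qed.

Lemma idsum_injl x a b (f : hom a b) : idsum x f ∘ injl x a = injl x b.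
Proof. by rewrite /idsum mcompDl -!mcompA prl_injl prr_injl mcompm1 !mcompm0 addr0. Qed.

Lemma idsum_transvection x a b (f : hom a b) (u : hom x a) :
  idsum x f ∘ transvection u = transvection (f ∘ u) ∘ idsum x f.
Proof.
rewrite /transvection 2!mcompDr 2!mcompDl -!mcompA prl_idsum prr_idsum.
by rewrite !(mcompA (idsum x f)) idsum_injl idsum_injr -!mcompA.
Qed.

End AdditiveTheory.

Section Functors.
Variables (k : fieldType) (A : additiveCategory).

Record kfunctor := KFunctor {
  kobj :> A -> lmodType k;
  kmap : forall a b, hom a b -> {linear kobj a -> kobj b};
  kmap1 : forall a v, kmap (idm a) v = v;
  kmapM : forall a b c (g : hom b c) (f : hom a b) v,
    kmap (g ∘ f) v = kmap g (kmap f v)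
}.

Record knat (F G : kfunctor) := KNat {
  kcomp :> forall a, {linear F a -> G a};
  knatP : forall a b (f : hom a b) v, kcomp b (kmap F f v) = kmap G f (kcomp a v)
}.

Definition kzero (F : kfunctor) : Prop := forall a (v : F a), v = 0.

Record subfunctor (F : kfunctor) := SubFunctor {
  sub_at :> forall a, submodClosed (F a);
  sub_stable : forall a b (f : hom a b),
    {in sub_at a, forall v, kmap F f v \in sub_at b}
}.

Section QuotientFunctor.
Variables (F : kfunctor) (S : subfunctor F).

Definition quotF_map a b (f : hom a b) : {linear quotmod (S a) -> quotmod (S b)} :=
  qmap (@sub_stable F S a b f).

Fact quotF_map1 a v : quotF_map (idm a) v = v.
Proof. by rewrite -[v]qproj_repr /= qmap_proj kmap1. Qed.

Fact quotF_mapM a b c (g : hom b c) (f : hom a b) v :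
  quotF_map (g ∘ f) v = quotF_map g (quotF_map f v).
Proof. by rewrite -[v]qproj_repr /= !qmap_proj kmapM. Qed.

Definition quotF : kfunctor :=
  KFunctor (kobj := fun a => quotmod (S a)) quotF_map1 quotF_mapM.

Fact quotF_proj_nat a b (f : hom a b) v :
  qproj (S b) (kmap F f v) = kmap quotF f (qproj (S a) v).
Proof. by rewrite /= qmap_proj. Qed.

Definition quotF_proj : knat F quotF :=
  @KNat F quotF (fun a => qproj (S a)) quotF_proj_nat.

End QuotientFunctor.

Section Cokernel.
Variables (F G : kfunctor) (eta : knat F G).

Fact image_stable a b (f : hom a b) :
  {in imagep (eta a), forall v, kmap G f v \in imagep (eta b)}.
Proof.
move=> _ /asboolP[u <-]; apply/asboolP.
by exists (kmap F f u); rewrite knatP.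
Qed.

Definition image_sub : subfunctor G :=
  SubFunctor (sub_at := fun a => imagep (eta a)) image_stable.

Definition coker : kfunctor := quotF image_sub.

End Cokernel.

Section Tau.
Variables (x : A) (F : kfunctor).

Fact tau_map1 a v : kmap F (idsum x (idm a)) v = v.
Proof. by rewrite idsum1 kmap1. Qed.

Fact tau_mapM a b c (g : hom b c) (f : hom a b) v :
  kmap F (idsum x (g ∘ f)) v = kmap F (idsum x g) (kmap F (idsum x f) v).
Proof. by rewrite idsumM kmapM. Qed.

Definition tau : kfunctor :=
  KFunctor (kobj := fun a => F (x ⊕ a))
    (kmap := fun a b (f : hom a b) => kmap F (idsum x f)) tau_map1 tau_mapM.

(* coinvariants are the quotient by the span of the [u.w - w] *)
Definition coinv_rel a (v : F (x ⊕ a)) : Prop :=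
  exists (u : hom x a) (w : F (x ⊕ a)), v = kmap F (transvection u) w - w.

Fact coinv_stable a b (f : hom a b) :
  {in spanp (@coinv_rel a), forall v, kmap tau f v \in spanp (@coinv_rel b)}.
Proof.
move=> v /asboolP Sv; apply/asboolP.
elim: Sv => [|c _ {}v [u [w ->]] _ IH]; first by rewrite raddf0; apply: spanned0.
rewrite linearP; apply: spannedP IH; exists (f ∘ u), (kmap F (idsum x f) w).
by rewrite raddfB /= -!kmapM idsum_transvection.
Qed.

Definition coinv_sub : subfunctor tau :=
  SubFunctor (F := tau) (sub_at := fun a => spanp (@coinv_rel a)) coinv_stable.

Definition tau_bar : kfunctor := quotF coinv_sub.

Fact incl_tau_nat a b (f : hom a b) v :
  kmap F (injr x b) (kmap F f v) = kmap tau f (kmap F (injr x a) v).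
Proof. by rewrite /= -!kmapM idsum_injr. Qed.

Definition incl_tau : knat F tau :=
  @KNat F tau (fun a => kmap F (injr x a)) incl_tau_nat.

Fact incl_tau_bar_nat a b (f : hom a b) v :
  quotF_proj coinv_sub b (incl_tau b (kmap F f v)) =
  kmap tau_bar f (quotF_proj coinv_sub a (incl_tau a v)).
Proof. by rewrite knatP knatP. Qed.

Definition incl_tau_bar : knat F tau_bar :=
  KNat (G := tau_bar)
    (kcomp := fun a => (quotF_proj coinv_sub a \o incl_tau a)%FUN)
    incl_tau_bar_nat.

Definition delta_bar : kfunctor := coker incl_tau_bar.

End Tau.

(* [in_Fpred n F] means that [F] belongs to [F_{n-1}(A; k)]: the index is
   shifted by one because the convention starts at [d = -1]. *)
Definition in_Fpred (n : nat) (F : kfunctor) : Prop :=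
  forall (s : seq A) (x : A), size s = n -> kzero (foldr delta_bar (tau x F) s).

Section Standard.
Variable a : A.

Definition reprF_map b c (g : hom b c) (v : {freeg (hom a b) / k}) :
  {freeg (hom a c) / k} := fglift (fun f : hom a b => << g ∘ f >>) v.

Fact fglift_is_linear (K : choiceType) (M : lmodType k) (h : K -> M) :
  linear (fglift h : {freeg K / k} -> M).
Proof.
have hD (u v : {freeg K / k}) : fglift h (u + v) = fglift h u + fglift h v.
  have hB := @lift_is_additive k K M h.
  have h0 : fglift h 0 = 0 by rewrite -[0 in LHS](subrr 0) hB subrr.
  by rewrite -[v in LHS]opprK hB -[- v]sub0r hB h0 sub0r opprK.
move=> c u v; rewrite hD; congr (_ + _).
have hS (I : Type) (r : seq I) (F : I -> {freeg K / k}) :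
    fglift h (\sum_(i <- r) F i) = \sum_(i <- r) fglift h (F i).
  elim: r => [|i r IH]; last by rewrite !big_cons hD IH.
  by rewrite !big_nil; apply: (addrI (fglift h 0)); rewrite -hD !addr0.
rewrite -[u]freeg_sumE scaler_sumr !hS scaler_sumr; apply: eq_bigr => i _.
set z := coeff i u; have -> : c *: << z *g i >> = << c * z *g i >>.
  by apply/eqP/freeg_eqP => j; rewrite coeffZ !coeffU mulrA.
by rewrite !liftU scalerA.
Qed.

Fact reprF_map_is_linear b c (g : hom b c) : linear (reprF_map g).
Proof. exact: fglift_is_linear. Qed.

HB.instance Definition _ b c (g : hom b c) :=
  GRing.isLinear.Build k _ _ _ (reprF_map g) (reprF_map_is_linear g).

Fact reprF_mapU b c (g : hom b c) z (f : hom a b) :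
  reprF_map g << z *g f >> = << z *g g ∘ f >>.
Proof.
rewrite /reprF_map liftU; apply/eqP/freeg_eqP => h.
by rewrite coeffZ !coeffU mul1r.
Qed.

Fact reprF_map1 b v : reprF_map (idm b) v = v.
Proof.
rewrite -[v]freeg_sumE raddf_sum; apply: eq_bigr => f _.
by rewrite /= reprF_mapU mcomp1m.
Qed.

Fact reprF_mapM b c d (h : hom c d) (g : hom b c) v :
  reprF_map (h ∘ g) v = reprF_map h (reprF_map g v).
Proof.
rewrite -[v]freeg_sumE !raddf_sum; apply: eq_bigr => f _.
by rewrite /= !reprF_mapU mcompA.
Qed.

(* the functor [k[A(a, -)]] *)
Definition reprF : kfunctor :=
  KFunctor (kobj := fun b => {freeg (hom a b) / k})
    (kmap := fun b c g => reprF_map g) reprF_map1 reprF_mapM.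

End Standard.

Definition zeroF : kfunctor :=
  @KFunctor (fun=> 'rV[k]_0) (fun _ _ _ => idfun)
    (fun _ _ => erefl) (fun _ _ _ _ _ _ => erefl).

Section Sum.
Variables F G : kfunctor.

Definition sum_map a b (f : hom a b) (v : (F a * G a)%type) : (F b * G b)%type :=
  (kmap F f v.1, kmap G f v.2).

Fact sum_map_is_linear a b (f : hom a b) : linear (sum_map f).
Proof. by move=> c u v; rewrite /sum_map !linearP. Qed.

HB.instance Definition _ a b (f : hom a b) :=
  GRing.isLinear.Build k _ _ _ (sum_map f) (sum_map_is_linear f).

Fact sum_map1 a v : sum_map (idm a) v = v.
Proof. by case: v => v w; rewrite /sum_map !kmap1. Qed.

Fact sum_mapM a b c (g : hom b c) (f : hom a b) v :
  sum_map (g ∘ f) v = sum_map g (sum_map f v).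
Proof. by rewrite /sum_map !kmapM. Qed.

Definition sumF : kfunctor :=
  KFunctor (kobj := fun a => (F a * G a)%type)
    (kmap := fun a b f => sum_map f) sum_map1 sum_mapM.

End Sum.

Definition finitely_generated (F : kfunctor) : Prop :=
  exists (s : seq A) (p : knat (foldr (fun a => sumF (reprF a)) zeroF s) F),
    forall a (v : F a), exists w, p a w = v.

End Functors.

Section Rep.
Variable A : additiveCategory.

Record rep := Rep {
  robj :> A -> zmodType;
  rmap : forall a b, hom a b -> {additive robj a -> robj b};
  rmap1 : forall a x, rmap (idm a) x = x;
  rmapM : forall a b c (g : hom b c) (f : hom a b) x,
    rmap (g ∘ f) x = rmap g (rmap f x);
  rmapD : forall a b (f g : hom a b) x, rmap (f + g) x = rmap f x + rmap g x
}.

Record rnat (M N : rep) := RNat {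
  rcomp :> forall a, {additive M a -> N a};
  rnatP : forall a b (f : hom a b) x, rcomp b (rmap M f x) = rmap N f (rcomp a x)
}.

Definition rzero (M : rep) : Prop := forall a (x : M a), x = 0.

Definition rmono (M N : rep) (i : rnat M N) : Prop := forall a, injective (i a).

Definition repi (M N : rep) (p : rnat M N) : Prop :=
  forall a (y : N a), exists x, p a x = y.

Definition short_exact (L M N : rep) (i : rnat L M) (p : rnat M N) : Prop :=
  [/\ rmono i, repi p
    & forall a (y : M a), p a y = 0 <-> exists x, i a x = y].

Definition simple_rep (S : rep) : Prop :=
  ~ rzero S /\
  forall (N : rep) (i : rnat N S), rmono i -> rzero N \/ repi i.

(* existence of a finite composition series, from the bottom up *)
Inductive finite_length : rep -> Prop :=
| finite_length0 M : rzero M -> finite_length M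
| finite_lengthS L M S (i : rnat L M) (p : rnat M S) :
    short_exact i p -> simple_rep S -> finite_length L -> finite_length M.

(* Objects satisfying [P] generate: the functors they represent are jointly
   faithful. *)
Definition generates (P : rep -> Prop) : Prop :=
  forall (M N : rep) (f g : rnat M N),
    (exists a (x : M a), f a x <> g a x) ->
    exists (L : rep) (h : rnat L M),
      P L /\ exists a (x : L a), f a (h a x) <> g a (h a x).

Definition locally_finite : Prop := generates finite_length.

End Rep.

(* Main.v *)
(** For a quotient [M] of [A(a,-)], splitting [M(x (+) b) = M(x) (+) M(b)] and
taking coinvariants gives [delta_bar_x k[M] = (+)_m k[M/(m)]], with [m] ranging
over the nonzero elements of [M(x)] and [(m)] the subobject generated by [m].
As no [k[N]] vanishes, [k[M]] lies in [F_d] iff there is no strict chain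
of more than [d] steps of subobjects of [M], i.e. iff [M] has length at most
[d].  Every finitely generated functor is a quotient of a finite sum of
functors [k[A(a,-)]], and [Rep(A)] is locally finite iff every [A(a,-)] has
finite length.  Infinite direct sums are avoided: upper bounds use spanning
sets that are images of the [k[A(a,-)/I]], lower bounds use the dual of an
epimorphism onto [k[A(a,-)/I]]. *)
Require Import Defs.
From HB Require Import structures.
From mathcomp Require Import all_boot all_algebra boolp.
From mathcomp.multinomials Require Import freeg.
(* [vector] shadows [hom] *)
Import Defs.

Set Implicit Arguments.
Unset Strict Implicit.
Unset Printing Implicit Defensive.

Import GRing.Theory.
Local Open Scope ring_scope.
Local Open Scope quotient_scope.

(** * Subobjects in [Rep(A)] and strict chains of them *)

Section Subrep.
Variable A : additiveCategory.

Lemma rmap0 (M : rep A) b c (x : M b) : rmap M (0 : hom b c) x = 0.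
Proof. by apply: (addrI (rmap M 0 x)); rewrite -rmapD !addr0. Qed.

Lemma rmapN (M : rep A) b c (f : hom b c) (x : M b) :
  rmap M (- f) x = - rmap M f x.
Proof. by apply: (addrI (rmap M f x)); rewrite -rmapD !subrr rmap0. Qed.

Record subrep (M : rep A) := Subrep {
  subrep_at :> forall b, M b -> Prop;
  subrep0 : forall b, subrep_at (0 : M b);
  subrepB : forall b (x y : M b), subrep_at x -> subrep_at y -> subrep_at (x - y);
  subrep_map : forall b c (f : hom b c) (x : M b),
    subrep_at x -> subrep_at (rmap M f x)
}.

Section Lattice.
Variable M : rep A.
Implicit Types I J K L : subrep M.

Lemma subrepN I b (x : M b) : I b x -> I b (- x).
Proof. by rewrite -sub0r; apply: subrepB; apply: subrep0. Qed.

Lemma subrepD I b (x y : M b) : I b x -> I b y -> I b (x + y).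
Proof. by move=> Ix Iy; rewrite -[y]opprK; apply/subrepB/subrepN. Qed.

Definition sub_le I J := forall b (x : M b), I b x -> J b x.

Definition sub0 : subrep M.
Proof.
exists (fun b x => x = 0) => // [b x y -> ->|b c f x ->]; first exact: subr0.
exact: raddf0.
Defined.

Definition subT : subrep M.
Proof. by exists (fun b x => True). Defined.

(** The sum [I + (m)]. A single [u] suffices because [M] is additive: [u.m - v.m = (u - v).m]. *)
Definition adjoin I c (m : M c) : subrep M.
Proof.
exists (fun b x => exists u : hom c b, I b (x - rmap M u m)) => [b|b x y|b d f x].
- by exists 0; rewrite rmap0 subr0; apply: subrep0.
- move=> [u Iu] [v Iv]; exists (u - v).
  by rewrite rmapD rmapN opprD addrACA -opprD; apply: subrepB.
by move=> [u Iu]; exists (f ∘ u); rewrite rmapM -raddfB; apply: subrep_map.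
Defined.


Lemma sub_le_adjoin I c (m : M c) : sub_le I (adjoin I m).
Proof. by move=> b x Ix; exists 0; rewrite rmap0 subr0. Qed.

Lemma in_adjoin I c (m : M c) : adjoin I m c m.
Proof. by exists (idm c); rewrite rmap1 subrr; apply: subrep0. Qed.

Lemma adjoin_le I J c (m : M c) : sub_le I J -> J c m -> sub_le (adjoin I m) J.
Proof.
move=> IJ Jm b x [u /IJ Ju]; rewrite -(subrK (rmap M u m) x).
by apply: subrepD => //; apply: subrep_map.
Qed.

(* [I < I_1 < ... < I_n <= K], the last inclusion being possibly an equality. *)
Fixpoint chain n I K : Prop :=
  if n is n'.+1 then
    exists c (m : M c), [/\ K c m, ~ I c m & chain n' (adjoin I m) K]
  else sub_le I K.

Lemma chain_le n I K : chain n I K -> sub_le I K.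
Proof.
elim: n I => [//|n IHn] I [c [m [_ _ /IHn le_IK]]] b x Ix.
exact/le_IK/sub_le_adjoin.
Qed.

Lemma chain_leq m n I K : (m <= n)%N -> chain n I K -> chain m I K.
Proof.
elim: m n I => [|m IHm] n I; first by move=> _ /chain_le.
case: n => // n le_mn [c [x [Kx nIx ch]]]; exists c, x; split=> //.
exact: IHm ch.
Qed.

(** Chains grow at the bottom by definition; this adds a step at the top. An element outside [K]
    lies outside the last term of the chain, so adjoining it there is a strict step that stays
    inside [L]. *)
Lemma chain_snoc n I K L b (x : M b) :
  chain n I K -> sub_le K L -> L b x -> ~ K b x -> chain n.+1 I L.
Proof.
move=> ch KL Lx nKx; elim: n I ch => [|n IHn] I /=.
  move=> IK; exists b, x; split=> // [/IK//|].
  by apply: adjoin_le => // c y /IK/KL.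
move=> [c [m [Km nIm /IHn ch]]]; exists c, m; split=> //; exact: KL.
Qed.

Lemma sub_not_le I J : ~ sub_le J I -> exists b (x : M b), J b x /\ ~ I b x.
Proof.
move=> nle; apply: contrapT => nex; apply: nle => b x Jx.
by apply: contrapT => nIx; apply: nex; exists b, x.
Qed.

(** Take for [L] a proper subobject of [K] that ends a chain of the greatest possible length. A
    subobject strictly between [L] and [K] would end a longer one. *)
Lemma exists_maximal_sub n K b (x : M b) :
  ~ chain n sub0 K -> K b x -> x <> 0 ->
  exists L, [/\ sub_le L K, ~ sub_le K L
    & forall J, sub_le L J -> sub_le J K -> sub_le J L \/ sub_le K J].
Proof.
move=> nch Kx x0.
pose P m := `[< exists L, [/\ chain m sub0 L, sub_le L K & ~ sub_le K L] >].
have exP : exists m, P m.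
  exists 0; apply/asboolP; exists sub0; split=> // [c y ->|/(_ b x Kx)//].
  exact: subrep0.
have ubP m : P m -> (m <= n)%N.
  move=> /asboolP[L [ch LK /sub_not_le[c [y [Ky nLy]]]]].
  rewrite leqNgt; apply/negP => lt_nm; apply: nch.
  by apply: chain_leq (chain_snoc ch LK Ky nLy); rewrite ltnW// ltnW.
case: (ex_maxnP exP ubP) => m /asboolP[L [ch LK nKL]] maxm.
exists L; split=> // J LJ JK.
have [|nKJ] := pselect (sub_le K J); first by right.
left; apply: contrapT => /sub_not_le[c [y [Jy nLy]]].
suff /maxm : P m.+1 by rewrite ltnn.
by apply/asboolP; exists J; split=> //; apply: chain_snoc ch LJ Jy nLy.
Qed.

End Lattice.

(** * Subobjects and quotients as objects of [Rep(A)], and transport along morphisms *)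

Section SubQuotient.
Variables (M : rep A) (N : subrep M).

(** The classical boolean form of [N], on which the subgroup and quotient group structures of the
    library are built. *)
Definition subrep_pred b : {pred M b} := fun x => `[< N b x >].
Arguments subrep_pred : clear implicits.

Fact subrep_pred_closed b : zmod_closed (subrep_pred b).
Proof.
by split=> [|x y /asboolP Nx /asboolP Ny]; apply/asboolP;
  [apply: subrep0 | apply: subrepB].
Qed.

HB.instance Definition _ b :=
  GRing.isZmodClosed.Build (M b) (subrep_pred b) (subrep_pred_closed b).

Definition sub_carrier b := {x : M b | x \in subrep_pred b}.

HB.instance Definition _ b := SubChoice.on (sub_carrier b).
HB.instance Definition _ b := [SubChoice_isSubZmodule of sub_carrier b by <:].

Lemma sub_carrierP b (x : sub_carrier b) : N b (val x).
Proof. exact/asboolP/(valP x). Qed.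

Lemma sub_map_in b c (f : hom b c) (x : sub_carrier b) :
  rmap M f (val x) \in subrep_pred c.
Proof. exact/asboolP/subrep_map/sub_carrierP. Qed.

Definition sub_map b c (f : hom b c) (x : sub_carrier b) : sub_carrier c :=
  Sub (rmap M f (val x)) (sub_map_in f x).

Fact sub_map_additive b c (f : hom b c) : zmod_morphism (sub_map f).
Proof. by move=> x y; apply: val_inj; rewrite /= !raddfB. Qed.

HB.instance Definition _ b c (f : hom b c) :=
  GRing.isZmodMorphism.Build _ _ (sub_map f) (sub_map_additive f).

Fact sub_map1 b x : sub_map (idm b) x = x.
Proof. by apply: val_inj; rewrite /= rmap1. Qed.

Fact sub_mapM b c d (g : hom c d) (f : hom b c) x :
  sub_map (g ∘ f) x = sub_map g (sub_map f x).
Proof. by apply: val_inj; rewrite /= rmapM. Qed.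

Fact sub_mapD b c (f g : hom b c) x :
  sub_map (f + g) x = sub_map f x + sub_map g x.
Proof. by apply: val_inj; rewrite /= rmapD. Qed.

Definition sub_rep : rep A :=
  @Rep A (fun b => sub_carrier b) (fun b c f => sub_map f)
    sub_map1 sub_mapM sub_mapD.

Definition sub_incl : rnat sub_rep M :=
  @RNat A sub_rep M (fun b => \val) (fun _ _ _ _ => erefl).

Definition quot_carrier b := Quotient.quot (subrep_pred b).

HB.instance Definition _ b := GRing.Zmodule.on (quot_carrier b).

Definition rproj b (x : M b) : quot_carrier b := \pi x.

Fact rproj_additive b : zmod_morphism (@rproj b).
Proof. exact: raddfB. Qed.

HB.instance Definition _ b :=
  GRing.isZmodMorphism.Build _ _ (@rproj b) (@rproj_additive b).

Lemma rproj_eq0 b (x : M b) : rproj x = 0 <-> N b x.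
Proof.
have e := Quotient.idealrBE (subrep_pred b) x 0; rewrite subr0 in e.
have -> : rproj x = 0 <-> x \in subrep_pred b.
  by rewrite e /rproj -[0 in X in X <-> _](raddf0 (@rproj b)); split=> /eqP.
by split=> /asboolP.
Qed.

Lemma rproj_repr b (x : quot_carrier b) : rproj (repr x) = x.
Proof. exact: reprK. Qed.

Definition quot_map b c (f : hom b c) (x : quot_carrier b) : quot_carrier c :=
  rproj (rmap M f (repr x)).

Lemma quot_map_proj b c (f : hom b c) x :
  quot_map f (rproj x) = rproj (rmap M f x).
Proof.
apply/eqP; rewrite -subr_eq0; apply/eqP; rewrite -!raddfB; apply/rproj_eq0.
by apply/subrep_map/rproj_eq0; rewrite raddfB /= rproj_repr subrr.
Qed.

Fact quot_map_additive b c (f : hom b c) : zmod_morphism (quot_map f).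
Proof.
move=> x y; rewrite -[x]rproj_repr -[y]rproj_repr -raddfB !quot_map_proj.
by rewrite !raddfB.
Qed.

HB.instance Definition _ b c (f : hom b c) :=
  GRing.isZmodMorphism.Build _ _ (quot_map f) (quot_map_additive f).

Fact quot_map1 b x : quot_map (idm b) x = x.
Proof. by rewrite -[x]rproj_repr quot_map_proj rmap1. Qed.

Fact quot_mapM b c d (g : hom c d) (f : hom b c) x :
  quot_map (g ∘ f) x = quot_map g (quot_map f x).
Proof. by rewrite -[x]rproj_repr !quot_map_proj rmapM. Qed.

Fact quot_mapD b c (f g : hom b c) x :
  quot_map (f + g) x = quot_map f x + quot_map g x.
Proof. by rewrite -[x]rproj_repr !quot_map_proj rmapD raddfD. Qed.

Definition quot_rep : rep A :=
  @Rep A (fun b => quot_carrier b) (fun b c f => quot_map f)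
    quot_map1 quot_mapM quot_mapD.

Definition quot_proj : rnat M quot_rep :=
  @RNat A M quot_rep (fun b => @rproj b) (fun b c f x => esym (quot_map_proj f x)).

End SubQuotient.

Arguments subrep_pred {M} N b.

Section Transport.
Variables (M N : rep A) (h : rnat M N).

Definition preim_sub (J : subrep N) : subrep M.
Proof.
exists (fun b x => J b (h b x)) => [b|b x y Jx Jy|b c f x Jx].
- by rewrite raddf0; apply: subrep0.
- by rewrite raddfB; apply: subrepB.
by rewrite rnatP; apply: subrep_map.
Defined.

Definition im_sub (I : subrep M) : subrep N.
Proof.
exists (fun b y => exists2 x, I b x & h b x = y) => [b|b y z|b c f y].
- by exists 0; [apply: subrep0 | rewrite raddf0].
- move=> [x Ix <-] [x' Ix' <-].
  by exists (x - x'); [apply: subrepB | rewrite raddfB].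
by move=> [x Ix <-]; exists (rmap M f x); [apply: subrep_map | rewrite rnatP].
Defined.

End Transport.

Section Widen.
Variables (M : rep A) (L K : subrep M) (LK : sub_le L K).

Lemma widen_in b (x : sub_carrier L b) : val x \in subrep_pred K b.
Proof. exact/asboolP/LK/sub_carrierP. Qed.

Definition widen b (x : sub_carrier L b) : sub_carrier K b :=
  Sub (val x) (widen_in x).

Fact widen_additive b : zmod_morphism (@widen b).
Proof. by move=> x y; apply: val_inj. Qed.

HB.instance Definition _ b :=
  GRing.isZmodMorphism.Build _ _ (@widen b) (@widen_additive b).

Fact widen_nat b c (f : hom b c) (x : sub_rep L b) :
  widen (rmap (sub_rep L) f x) = rmap (sub_rep K) f (widen x).
Proof. exact: val_inj. Qed.

Definition widen_rnat : rnat (sub_rep L) (sub_rep K) :=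
  @RNat A (sub_rep L) (sub_rep K) (fun b => @widen b) widen_nat.

End Widen.

(** * Finite length, finite height and bounds on chains *)

Definition to_sub (M : rep A) (K : subrep M) b (x : M b) (Kx : K b x) :
  sub_rep K b := Sub x (introT (asboolP (K b x)) Kx).

(** Subobjects of [K/L] correspond to subobjects of [M] between [L] and [K]. *)
Lemma simple_maximal_quot (M : rep A) (K L : subrep M) :
  sub_le L K -> ~ sub_le K L ->
  (forall J, sub_le L J -> sub_le J K -> sub_le J L \/ sub_le K J) ->
  simple_rep (quot_rep (preim_sub (sub_incl K) L)).
Proof.
move=> LK nKL maxL; set L' := preim_sub _ _; split=> [S0|N i i_inj].
  apply: nKL => b x Kx.
  by have /rproj_eq0 := S0 b (rproj L' (to_sub Kx)).
(* The image of [i] in [K/L], pulled back to [K] and then viewed inside [M]. *)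
pose J := im_sub (sub_incl K) (preim_sub (quot_proj L') (im_sub i (subT N))).
have LJ : sub_le L J.
  move=> b x Lx; exists (to_sub (LK _ _ Lx)) => //; exists 0 => //.
  by rewrite raddf0; apply/esym/rproj_eq0.
have JK : sub_le J K by move=> b _ [x _ <-]; apply: sub_carrierP.
have [JL|KJ] := maxL J LJ JK.
  left=> b y; apply: i_inj; rewrite raddf0 -[LHS]rproj_repr; apply/rproj_eq0.
  by apply/JL; exists (repr (i b y)) => //; exists y => //=; rewrite rproj_repr.
right=> b z; have [x [y _ iy] xz] := KJ b _ (sub_carrierP (repr z)).
by exists y; rewrite iy -[z]rproj_repr; congr rproj; apply: val_inj.
Qed.

(** A maximal proper subobject [L] of [K] has a simple quotient [K/L] and admits chains shorter by
    one step, so induction on [n] builds a composition series. *)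
Lemma finite_length_sub (M : rep A) n (K : subrep M) :
  ~ chain n (sub0 M) K -> finite_length (sub_rep K).
Proof.
elim: n K => [|n IHn] K nch.
  by case: nch => b x ->; apply: subrep0.
have [[b [x [Kx x0]]]|K0] := pselect (exists b (x : M b), K b x /\ x <> 0).
  have [L [LK nKL maxL]] := exists_maximal_sub nch Kx x0.
  have [c [y [Ky nLy]]] := sub_not_le nKL.
  apply: (@finite_lengthS _ (sub_rep L) _ _ (widen_rnat LK)
    (quot_proj (preim_sub (sub_incl K) L))); last 1 first.
  - by apply: IHn => ch; apply: nch; apply: chain_snoc ch LK Ky nLy.
  - split=> [d u v uv|d z|d u].
    + by apply: val_inj; rewrite -[LHS]/(val (widen LK u)) [widen LK u]uv.
    + by exists (repr z); apply: rproj_repr.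
    split=> [/rproj_eq0 Lu|[v <-]]; last exact/rproj_eq0/sub_carrierP.
    by exists (@to_sub M L d (val u) Lu); apply: val_inj.
  exact: simple_maximal_quot.
apply: finite_length0 => b x; apply: val_inj; apply: contrapT => x0.
by apply: K0; exists b, (val x); split; first exact: sub_carrierP.
Qed.

(** The function [mu] plays the part of the length of a subobject. Boundedness and strict
    monotonicity are enough to bound chains, without the Jordan-Hölder theorem. *)
Definition finite_height (M : rep A) : Prop :=
  exists (mu : subrep M -> nat) (B : nat),
  [/\ forall I, (mu I <= B)%N,
      forall I J, sub_le I J -> (mu I <= mu J)%N
    & forall I J, sub_le I J -> ~ sub_le J I -> (mu I < mu J)%N].

Lemma finite_height_zero M : rzero M -> finite_height M.
Proof.
move=> M0; exists (fun=> 0%N), 0%N; split=> // I J _ [] b x _.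
by rewrite (M0 b x); apply: subrep0.
Qed.

Lemma finite_height_simple S : simple_rep S -> finite_height S.
Proof.
move=> [_ simS]; exists (fun I => nat_of_bool (~~ `[< sub_le I (sub0 S) >])), 1%N.
have le0 I : sub_le (sub0 S) I by move=> b x ->; apply: subrep0.
split=> [I|I J IJ|I J IJ nJI]; first exact: leq_b1.
  case: (asboolP (sub_le J _)) => [J0|_]; last exact: leq_b1.
  by case: asboolP => // -[] b x /IJ/J0.
case: (asboolP (sub_le J _)) => [J0|_]; first by case: nJI => b x /J0/le0.
case: (asboolP (sub_le I _)) => // nI0.
have [|I0|epi] := simS _ (sub_incl I); first by move=> b; apply: val_inj.
  by case: nI0 => b x Ix; have /(congr1 val) := I0 b (to_sub Ix).
by case: nJI => b x _; have [y <-] := epi b x; apply: sub_carrierP.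
Qed.

(** Ranks add up along the extension. Strictness is the modular law: if [I <= J] have the same trace
    on [L] and the same image in [S], then an element of [J] differs from one of [I] by an element
    of that trace, so [I = J]. *)
Lemma finite_height_ext L M S (i : rnat L M) (p : rnat M S) :
  short_exact i p -> finite_height L -> finite_height S -> finite_height M.
Proof.
move=> [_ _ ex_ip] [muL [BL [ubL homL ltL]]] [muS [BS [ubS homS ltS]]].
have lepre I J : sub_le I J -> sub_le (preim_sub i I) (preim_sub i J).
  by move=> IJ b x /IJ.
have leim I J : sub_le I J -> sub_le (im_sub p I) (im_sub p J).
  by move=> IJ b _ [x /IJ Jx <-]; exists x.
exists (fun I => muL (preim_sub i I) + muS (im_sub p I))%N, (BL + BS)%N.
split=> [I|I J IJ|I J IJ nJI]; first by rewrite leq_add.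
  by rewrite leq_add ?homL ?homS //; [apply: lepre | apply: leim].
have [preJI|npre] := pselect (sub_le (preim_sub i J) (preim_sub i I)).
  have nim : ~ sub_le (im_sub p J) (im_sub p I).
    move=> imJI; apply: nJI => b y Jy.
    have [|z Iz pz] := imJI b (p b y); first by exists y.
    have [x ix] : exists x, i b x = y - z.
      by apply/ex_ip; rewrite raddfB pz subrr.
    rewrite -(subrK z y) -ix; apply: subrepD => //; apply: preJI.
    by rewrite /= ix; apply: subrepB => //; apply: IJ.
  by rewrite -addnS leq_add ?homL ?ltS //; [apply: lepre | apply: leim].
by rewrite -addSn leq_add ?ltL ?homS //; [apply: lepre | apply: leim].
Qed.

Lemma finite_length_height M : finite_length M -> finite_height M.
Proof.
elim=> [{}M|L {}M S i p ex_ip simS _ htL]; first exact: finite_height_zero.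
exact: finite_height_ext ex_ip htL (finite_height_simple simS).
Qed.

Lemma finite_height_epi L M (h : rnat L M) :
  repi h -> finite_height L -> finite_height M.
Proof.
move=> epi [mu [B [ub hom_mu lt_mu]]].
exists (fun I => mu (preim_sub h I)), B; split=> // [I J IJ|I J IJ nJI].
  by apply: hom_mu => b x; apply: IJ.
apply: lt_mu => [b x|JI]; first exact: IJ.
by apply: nJI => b y; have [x <-] := epi b y; apply: JI.
Qed.

(** Each step of a chain raises [mu] by at least one, so [B.+1] steps would exceed the bound. *)
Lemma finite_height_no_chain M (I K : subrep M) :
  finite_height M -> exists n, ~ chain n I K.
Proof.
move=> [mu [B [ub hom_mu lt_mu]]]; exists B.+1.
suff bound n : chain n I K -> (n + mu I <= mu K)%N.
  move=> /bound/leq_trans/(_ (ub K)); rewrite addSn ltnNge => /negP; apply.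
  exact: leq_addr.
elim: n I => [|n IHn] I; first exact: hom_mu.
move=> [c [m [_ nIm /IHn]]]; apply: leq_trans; rewrite addSnnS leq_add2l.
by apply: lt_mu => [|/(_ c m (in_adjoin I m))]; first exact: sub_le_adjoin.
Qed.

(** * Binary direct sums and composition of morphisms *)

Section SumRep.
Variables M N : rep A.

Definition pair_map b c (f : hom b c) (x : M b * N b) : (M c * N c)%type :=
  (rmap M f x.1, rmap N f x.2).

Fact pair_map_additive b c (f : hom b c) : zmod_morphism (pair_map f).
Proof. by move=> x y; rewrite /pair_map !raddfB. Qed.

HB.instance Definition _ b c (f : hom b c) :=
  GRing.isZmodMorphism.Build _ _ (pair_map f) (pair_map_additive f).

Fact pair_map1 b x : pair_map (idm b) x = x.
Proof. by case: x => x y; rewrite /pair_map !rmap1. Qed.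

Fact pair_mapM b c d (g : hom c d) (f : hom b c) x :
  pair_map (g ∘ f) x = pair_map g (pair_map f x).
Proof. by rewrite /pair_map !rmapM. Qed.

Fact pair_mapD b c (f g : hom b c) x :
  pair_map (f + g) x = pair_map f x + pair_map g x.
Proof. by rewrite /pair_map !rmapD. Qed.

Definition sum_rep : rep A :=
  @Rep A (fun b => (M b * N b)%type) (fun b c f => pair_map f)
    pair_map1 pair_mapM pair_mapD.

Definition pair_inl b (x : M b) : (M b * N b)%type := (x, 0).

Fact pair_inl_additive b : zmod_morphism (@pair_inl b).
Proof. by move=> x y; rewrite /pair_inl -[in LHS](subr0 0). Qed.

HB.instance Definition _ b :=
  GRing.isZmodMorphism.Build _ _ (@pair_inl b) (@pair_inl_additive b).

Fact pair_inl_nat b c (f : hom b c) (x : M b) :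
  pair_inl (rmap M f x) = rmap sum_rep f (pair_inl x).
Proof. by rewrite /= /pair_map /= raddf0. Qed.

Definition sum_inl : rnat M sum_rep :=
  @RNat A M sum_rep (fun b => @pair_inl b) pair_inl_nat.

Definition sum_snd : rnat sum_rep N :=
  @RNat A sum_rep N (fun b => snd) (fun _ _ _ _ => erefl).

Lemma finite_height_sum :
  finite_height M -> finite_height N -> finite_height sum_rep.
Proof.
apply: (finite_height_ext (i := sum_inl) (p := sum_snd)); split.
- by move=> b x y [].
- by move=> b y; exists (0, y).
by move=> b [x y]; split=> [/= ->|[z [_ <-]]] //; exists x.
Qed.

Variables (P : rep A) (f : rnat M P) (g : rnat N P).

Definition copair b (x : M b * N b) : P b := f b x.1 + g b x.2.

Fact copair_additive b : zmod_morphism (@copair b).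
Proof. by move=> x y; rewrite /copair !raddfB addrACA -opprD. Qed.

HB.instance Definition _ b :=
  GRing.isZmodMorphism.Build _ _ (@copair b) (@copair_additive b).

Fact copair_nat b c (h : hom b c) x :
  copair (rmap sum_rep h x) = rmap P h (copair x).
Proof. by rewrite /copair /= !rnatP raddfD. Qed.

Definition sum_copair : rnat sum_rep P :=
  @RNat A sum_rep P (fun b => @copair b) copair_nat.

End SumRep.

Section CompRnat.
Variables (L M N : rep A) (g : rnat M N) (f : rnat L M).

Fact comp_rnat_nat b c (h : hom b c) (x : L b) :
  (g c \o f c)%FUN (rmap L h x) = rmap N h ((g b \o f b)%FUN x).
Proof. by rewrite /= !rnatP. Qed.

Definition comp_rnat : rnat L N :=
  @RNat A L N (fun b => (g b \o f b)%FUN) comp_rnat_nat.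

End CompRnat.

(** * Representable objects and a criterion for local finiteness *)

Section Hom.

Lemma mcompmN (a b c : A) (g : hom b c) (f : hom a b) : g ∘ - f = - (g ∘ f).
Proof. by apply: (addrI (g ∘ f)); rewrite -mcompDr !subrr mcompm0. Qed.

Fact mcomp_additive (a b c : A) (g : hom b c) : zmod_morphism (@mcomp A a b c g).
Proof. by move=> f f'; rewrite mcompDr mcompmN. Qed.

HB.instance Definition _ (a b c : A) (g : hom b c) :=
  GRing.isZmodMorphism.Build _ _ (@mcomp A a b c g) (@mcomp_additive a b c g).

Definition hom_rep (a : A) : rep A :=
  @Rep A (fun b => hom a b) (fun b c g => @mcomp A a b c g)
    (fun b f => mcomp1m f) (fun b c d h g f => esym (mcompA h g f))
    (fun b c g g' f => mcompDl g g' f).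

Definition yoneda (M : rep A) a (x : M a) b (f : hom a b) : M b := rmap M f x.

Fact yoneda_additive (M : rep A) a (x : M a) b : zmod_morphism (@yoneda M a x b).
Proof. by move=> f g; rewrite /yoneda rmapD rmapN. Qed.

HB.instance Definition _ (M : rep A) a (x : M a) b :=
  GRing.isZmodMorphism.Build _ _ (@yoneda M a x b) (@yoneda_additive M a x b).

Fact yoneda_nat (M : rep A) a (x : M a) b c (g : hom b c) (f : hom_rep a b) :
  yoneda x (rmap (hom_rep a) g f) = rmap M g (yoneda x f).
Proof. exact: rmapM. Qed.

Definition yoneda_rnat (M : rep A) a (x : M a) : rnat (hom_rep a) M :=
  @RNat A (hom_rep a) M (@yoneda M a x) (@yoneda_nat (M : rep A) a x).

End Hom.

Fact zero_rnat_nat (M N : rep A) b c (f : hom b c) (x : M b) :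
  (\0 : M c -> N c)%R (rmap M f x) = rmap N f ((\0 : M b -> N b)%R x).
Proof. by rewrite /= raddf0. Qed.

Definition zero_rnat (M N : rep A) : rnat M N :=
  @RNat A M N (fun b => \0%R) (@zero_rnat_nat M N).

(* The sum of all the images of objects of finite height. *)
Definition finite_height_trace (M : rep A) : subrep M.
Proof.
exists (fun b x => exists (L : rep A) (h : rnat L M),
  finite_height L /\ exists y, h b y = x) => [b|b x x'|b c f x].
- exists (sub_rep (sub0 M)), (sub_incl (sub0 M)); split.
    by apply: finite_height_zero => c x; apply: val_inj; apply: (sub_carrierP x).
  by exists 0; rewrite raddf0.
- move=> [L [h [htL [y <-]]]] [L' [h' [htL' [y' <-]]]].
  exists (sum_rep L L'), (sum_copair h h'); split; first exact: finite_height_sum.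
  by exists (y, - y'); rewrite /= /copair /= raddfN.
by move=> [L [h [htL [y <-]]]]; exists L, h; split=> //; exists (rmap L f y);
  rewrite rnatP.
Defined.

(** If objects of finite length generate, then [idm a] lies in the image of an object of finite
    height, which therefore maps onto [hom_rep a]. Conversely, the [hom_rep a] generate by Yoneda,
    and bounded chains make them of finite length. *)
Lemma locally_finiteP :
  locally_finite A <->
  forall a, exists n, ~ chain n (sub0 (hom_rep a)) (subT (hom_rep a)).
Proof.
split=> [lf a|bd M N f g [a [x fgx]]].
  apply: finite_height_no_chain.
  pose T := finite_height_trace (hom_rep a).
  have [L [h [htL [y hy]]]] : T a (idm a).
    (* Otherwise the projection modulo [T] differs from zero, so a morphism from an object of finite
       length detects it; but the image of that morphism lies in [T]. *)
    apply: contrapT => nT.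
    have [|L [h [fL [b [y]]]]] :=
        lf _ _ (quot_proj T) (zero_rnat (hom_rep a) (quot_rep T)).
      by exists a, (idm a) => /rproj_eq0.
    case; apply/rproj_eq0; exists L, h; split; first exact: finite_length_height.
    by exists y.
  (* Since [h] reaches [idm a], naturality makes it reach every [f = f ∘ idm a]. *)
  apply: (finite_height_epi (h := h)) htL => b f; exists (rmap L f y).
  by rewrite rnatP hy; apply: mcompm1.
have [n /finite_length_sub fl] := bd a.
(* The test object is [hom_rep a], presented as its largest subobject to match [finite_length_sub];
   [idm a] is sent to [x]. *)
exists (sub_rep (subT (hom_rep a))), (comp_rnat (yoneda_rnat x) (sub_incl _)).
split=> //; exists a, (@to_sub _ (subT (hom_rep a)) a (idm a) I).
by rewrite /= /yoneda rmap1.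
Qed.

End Subrep.

(** * Linear spans and linear maps determined on them *)

Section Spanned.
Variables (k : fieldType) (U V : lmodType k).

Lemma spanned_gen (P : V -> Prop) v : P v -> spanned P v.
Proof.
by move=> Pv; rewrite -[v]addr0 -[v]scale1r; apply: spannedP (spanned0 P).
Qed.

Lemma spannedD (P : V -> Prop) u v :
  spanned P u -> spanned P v -> spanned P (u + v).
Proof.
elim=> [|c x y Px _ IH] Pv; first by rewrite add0r.
by rewrite -addrA; apply: spannedP (IH Pv).
Qed.

Lemma spannedZ (P : V -> Prop) c v : spanned P v -> spanned P (c *: v).
Proof.
elim=> [|a x y Px _ IH]; first by rewrite scaler0; apply: spanned0.
by rewrite scalerDr scalerA; apply: spannedP.
Qed.

Lemma spanned_map (P : U -> Prop) (Q : V -> Prop) (f : {linear U -> V}) u :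
  (forall x, P x -> spanned Q (f x)) -> spanned P u -> spanned Q (f u).
Proof.
move=> PQ; elim=> [|c x y /PQ Qx _ IH]; first by rewrite raddf0; apply: spanned0.
by rewrite linearP; apply: spannedD => //; apply: spannedZ.
Qed.

End Spanned.

Section Linear.
Variables (k : fieldType) (V W : lmodType k).

Lemma linear_pred0 (f : V -> W) : linear f -> f 0 = 0.
Proof.
move=> lf; apply: (addrI (f 0)).
by have := lf 1 0 0; rewrite !scale1r !addr0 => /esym.
Qed.

Lemma linear_eq_spanned (P : V -> Prop) (f g : V -> W) :
  linear f -> linear g -> (forall v, P v -> f v = g v) ->
  forall v, spanned P v -> f v = g v.
Proof.
move=> lf lg fg v; elim=> [|c x y /fg xE _ IH]; first by rewrite !linear_pred0.
by rewrite lf lg xE IH.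
Qed.

Lemma freeg_spanned (T : choiceType) (w : {freeg T / k}) :
  spanned (fun v => exists x, v = << x >>) w.
Proof.
rewrite -[w]freeg_sumE.
elim: (dom w) => [|x s IHs]; first by rewrite big_nil; apply: spanned0.
rewrite big_cons; apply: spannedD IHs.
have -> : << coeff x w *g x >> = coeff x w *: << x >> :> {freeg T / k}.
  by apply/eqP/freeg_eqP => y; rewrite coeffZ !coeffU mul1r.
by apply/spannedZ/spanned_gen; exists x.
Qed.

End Linear.

(** * Morphisms into [x ⊕ a] and computation in [delta_bar] *)

Section Functors.
Variables (k : fieldType) (A : additiveCategory).
Implicit Types (F G : kfunctor k A) (a b c x : A).

Lemma hom_ext x a b (h h' : hom b (x ⊕ a)) :
  prl x a ∘ h = prl x a ∘ h' -> prr x a ∘ h = prr x a ∘ h' -> h = h'.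
Proof.
move=> el er; rewrite -[h]mcomp1m -[h']mcomp1m -dsumE !mcompDl -!mcompA.
by rewrite el er.
Qed.

Lemma prl_transvection x a (u : hom x a) : prl x a ∘ transvection u = prl x a.
Proof.
rewrite /transvection !mcompDr !mcompA prl_injl prl_injr mcomp1m !mcomp0m.
by rewrite !addr0.
Qed.

Lemma prr_transvection x a (u : hom x a) :
  prr x a ∘ transvection u = u ∘ prl x a + prr x a.
Proof.
by rewrite /transvection !mcompDr !mcompA prr_injl prr_injr !mcomp1m !mcomp0m add0r.
Qed.

Definition pairing x a b (f : hom b x) (g : hom b a) : hom b (x ⊕ a) :=
  injl x a ∘ f + injr x a ∘ g.

Lemma prl_pairing x a b (f : hom b x) (g : hom b a) : prl x a ∘ pairing f g = f.
Proof. by rewrite mcompDr !mcompA prl_injl prl_injr mcomp1m mcomp0m addr0. Qed.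

Lemma prr_pairing x a b (f : hom b x) (g : hom b a) : prr x a ∘ pairing f g = g.
Proof. by rewrite mcompDr !mcompA prr_injl prr_injr mcomp1m mcomp0m add0r. Qed.

Lemma pairing_eta x a b (h : hom b (x ⊕ a)) :
  pairing (prl x a ∘ h) (prr x a ∘ h) = h.
Proof. by apply: hom_ext; rewrite ?prl_pairing ?prr_pairing. Qed.

Lemma idsum_pairing x a b c (f : hom c x) (g : hom c a) (h : hom a b) :
  idsum x h ∘ pairing f g = pairing f (h ∘ g).
Proof.
by apply: hom_ext; rewrite mcompA ?prl_idsum ?prr_idsum -?mcompA
  ?prl_pairing ?prr_pairing.
Qed.

(** This is where the subobject generated by [f] enters: passing to coinvariants identifies [g] with
    all the [u ∘ f + g]. *)
Lemma transvection_pairing x a b (f : hom b x) (g : hom b a) (u : hom x a) :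
  transvection u ∘ pairing f g = pairing f (u ∘ f + g).
Proof.
by apply: hom_ext; rewrite mcompA ?prl_transvection ?prr_transvection
  ?mcompDl -?mcompA !(prl_pairing, prr_pairing).
Qed.

(** The composite of the two quotient maps, so that [delta_bar] can be handled through elements of
    [F (x ⊕ b)]. *)
Definition delta_proj x F b (w : F (x ⊕ b)) : delta_bar x F b :=
  quotF_proj (image_sub (incl_tau_bar x F)) b (quotF_proj (coinv_sub x F) b w).

Arguments delta_proj : simpl never.

Fact delta_proj_linear x F b : linear (@delta_proj x F b).
Proof. by move=> c v w; rewrite /delta_proj !linearP. Qed.

HB.instance Definition _ x F b := GRing.isLinear.Build k _ _ _ (@delta_proj x F b)
  (@delta_proj_linear x F b).

Lemma delta_proj_nat x F b c (f : hom b c) (w : F (x ⊕ b)) :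
  delta_proj (kmap F (idsum x f) w) = kmap (delta_bar x F) f (delta_proj w).
Proof. by rewrite /delta_proj -[kmap F _ w]/(kmap (tau x F) f w) !knatP. Qed.

Lemma delta_proj_surj x F b (v : delta_bar x F b) :
  exists w, delta_proj (w : F (x ⊕ b)) = v.
Proof. by exists (repr (repr v)); rewrite /delta_proj /= !qproj_repr. Qed.

Lemma delta_proj_injr x F b (w : F b) : delta_proj (kmap F (injr x b) w) = 0.
Proof. by apply/eqP; rewrite qproj_eq0; apply/asboolP; exists w. Qed.

Lemma delta_proj_transvection x F b (u : hom x b) (w : F (x ⊕ b)) :
  delta_proj (kmap F (transvection u) w) = delta_proj w.
Proof.
apply/eqP; rewrite -subr_eq0 -raddfB /delta_proj; apply/eqP.
rewrite [X in quotF_proj _ _ X = _](_ : _ = 0) ?raddf0 //.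
by apply/eqP; rewrite qproj_eq0; apply/asboolP/spanned_gen; exists u, w.
Qed.

Lemma delta_proj_ker x F b (w : F (x ⊕ b)) :
  delta_proj w = 0 ->
  exists w0, spanned (@coinv_rel _ _ x F b) (w - kmap F (injr x b) w0).
Proof.
move=> /eqP; rewrite qproj_eq0 => /asboolP[w0 /= e]; exists w0.
have : qproj (coinv_sub x F b) (w - kmap F (injr x b) w0) == 0.
  by rewrite raddfB /= e subrr.
by rewrite qproj_eq0 => /asboolP.
Qed.

(** * Upper bound on the degree, by spanning sets *)

Definition invariant_elt F a (I : subrep (hom_rep a)) (e : F a) :=
  forall c (f g : hom_rep a c), I c (f - g) -> kmap F f e = kmap F g e.

(* By Yoneda, [e] is a morphism [k[A(a,-)/I] -> F], and [A(a,-)/I] has length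
   less than [n]. *)
Definition colength_gen n F b (w : F b) : Prop :=
  exists a (I : subrep (hom_rep a)) (e : F a) (h : hom a b),
    [/\ ~ chain n I (subT (hom_rep a)), invariant_elt I e & w = kmap F h e].

Definition colength_gens n F : Prop :=
  forall b (w : F b), spanned (@colength_gen n F b) w.

(** A chain with no step always exists, so the spanning set is empty. *)
Lemma colength_gens0 F : colength_gens 0 F -> kzero F.
Proof.
move=> gF b w; case: (gF b w) => // c u v [a [I [e [h [nch _ _]]]]].
by case: nch.
Qed.

Lemma colength_gens_leq m n F :
  (m <= n)%N -> colength_gens m F -> colength_gens n F.
Proof.
move=> le_mn gF b w; elim: (gF b w) => [|c u v [a [I [e [h [nch Ie ->]]]]] _ IH].
  exact: spanned0.
apply: spannedP IH; exists a, I, e, h; split=> // /(chain_leq le_mn); exact: nch.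
Qed.

(** The first component of [h] is absorbed into the generator [e'], and the second one becomes the
    new morphism; [I] is unchanged. *)
Lemma colength_gens_tau n x F : colength_gens n F -> colength_gens n (tau x F).
Proof.
move=> gF b w; elim: {w}(gF _ (w : F (x ⊕ b)))
  => [|c u v [a [I [e [h [nch Ie ->]]]]] _ IH].
  exact: spanned0.
apply: (spannedP c _ IH).
pose e' : tau x F a := kmap F (pairing (prl x b ∘ h) (idm a)) e.
exists a, I, e', (prr x b ∘ h); split=> // [d f g Ifg|].
  rewrite /= -!kmapM !idsum_pairing !mcompm1; apply: Ie.
  rewrite /pairing opprD addrACA subrr add0r -raddfB.
  by apply: (subrep_map (injr x d) Ifg).
by rewrite /= -kmapM idsum_pairing mcompm1 pairing_eta.
Qed.

(** Let [f] be the component of [h] in [x]. If [f] lies in [I], the generator comes from [F b] and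
    dies. Otherwise coinvariance makes it invariant modulo [I + (f)], above which chains lose one
    step. *)
Lemma colength_gens_delta n x F :
  colength_gens n.+1 F -> colength_gens n (delta_bar x F).
Proof.
move=> gF b v; have [w <-] := delta_proj_surj v.
apply: (spanned_map (f := @delta_proj x F b)) (gF _ w)
  => {w} _ [a [I [e [h [nch Ie ->]]]]] /=.
have [If|nIf] := pselect (I x (prl x b ∘ h)).
  suff -> : kmap F h e = kmap F (injr x b) (kmap F (prr x b ∘ h) e).
    by rewrite delta_proj_injr; apply: spanned0.
  rewrite -kmapM; apply: Ie; rewrite -[h in h - _]pairing_eta addrK.
  exact: (subrep_map (injl x b) If).
apply: spanned_gen; set f := _ ∘ h in nIf.
pose e' := delta_proj (kmap F (pairing f (idm a)) e).
have eE c (g : hom a c) : kmap (delta_bar x F) g e' =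
    delta_proj (kmap F (pairing f g) e).
  by rewrite -delta_proj_nat -kmapM idsum_pairing mcompm1.
exists a, (adjoin I (f : hom_rep a x)), e', (prr x b ∘ h); split.
- by move=> ch; apply: nch; exists x, f.
- move=> c g g' [u Iu]; rewrite !eE.
  (* Modulo [I], [g - g'] equals [u ∘ f], which the transvection by [u] adds to [g']. *)
  rewrite -(delta_proj_transvection u (kmap F (pairing f g') e)).
  rewrite -kmapM transvection_pairing; congr delta_proj; apply: Ie.
  rewrite /pairing opprD addrACA subrr add0r -raddfB.
  by apply: (subrep_map (injr x c)); rewrite opprD addrA addrAC.
by rewrite eE pairing_eta.
Qed.

Lemma colength_gens_foldr_delta n s F :
  colength_gens (n + size s) F -> colength_gens n (foldr (@delta_bar k A) F s).
Proof.
elim: s n => [|x s IHs] n /=; first by rewrite addn0.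
by rewrite addnS -addSn => /IHs; apply: colength_gens_delta.
Qed.

Lemma colength_gens_in_Fpred n F : colength_gens n F -> in_Fpred n F.
Proof.
move=> gF s x sz; apply/colength_gens0/colength_gens_foldr_delta.
by rewrite add0n sz; apply: colength_gens_tau.
Qed.

Section SumKnat.
Variables F G : kfunctor k A.

Definition sumF_inl b (v : F b) : (F b * G b)%type := (v, 0).
Definition sumF_inr b (v : G b) : (F b * G b)%type := (0, v).

Fact sumF_inl_linear b : linear (@sumF_inl b).
Proof. by move=> c u v; congr (_, _); rewrite /= scaler0 addr0. Qed.

Fact sumF_inr_linear b : linear (@sumF_inr b).
Proof. by move=> c u v; congr (_, _); rewrite /= scaler0 addr0. Qed.

HB.instance Definition _ b :=
  GRing.isLinear.Build k _ _ _ (@sumF_inl b) (@sumF_inl_linear b).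
HB.instance Definition _ b :=
  GRing.isLinear.Build k _ _ _ (@sumF_inr b) (@sumF_inr_linear b).

Fact sumF_inl_nat b c (f : hom b c) (v : F b) :
  sumF_inl (kmap F f v) = kmap (sumF F G) f (sumF_inl v).
Proof. by rewrite /= /sum_map /= raddf0. Qed.

Fact sumF_inr_nat b c (f : hom b c) (v : G b) :
  sumF_inr (kmap G f v) = kmap (sumF F G) f (sumF_inr v).
Proof. by rewrite /= /sum_map /= raddf0. Qed.

Definition sumF_inl_knat : knat F (sumF F G) :=
  @KNat k A F (sumF F G) (fun b => @sumF_inl b) sumF_inl_nat.

Definition sumF_inr_knat : knat G (sumF F G) :=
  @KNat k A G (sumF F G) (fun b => @sumF_inr b) sumF_inr_nat.

End SumKnat.

Lemma colength_gens_image n F G (p : knat F G) :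
  colength_gens n F -> forall b v, spanned (@colength_gen n G b) (p b v).
Proof.
move=> gF b v; apply: spanned_map (gF b v) => _ [a [I [e [h [nch Ie ->]]]]].
apply: spanned_gen; exists a, I, (p a e), h; rewrite knatP.
by split=> // c f g /Ie fg; rewrite -!knatP fg.
Qed.

Lemma colength_gens_zeroF n : colength_gens n (zeroF k A).
Proof. by move=> b w; rewrite (thinmx0 w); apply: spanned0. Qed.

Lemma colength_gens_sumF n F G :
  colength_gens n F -> colength_gens n G -> colength_gens n (sumF F G).
Proof.
move=> gF gG b [v w]; have -> : (v, w) = sumF_inl G v + sumF_inr F w.
  by congr (_, _); rewrite /= ?addr0 ?add0r.
apply: spannedD; first exact: (colength_gens_image (sumF_inl_knat F G)).
exact: (colength_gens_image (sumF_inr_knat F G)).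
Qed.

Lemma colength_gens_reprF n a :
  ~ chain n (sub0 (hom_rep a)) (subT (hom_rep a)) -> colength_gens n (reprF k a).
Proof.
move=> nch b w; apply: (spanned_map (f := idfun)) (freeg_spanned w) => _ [f ->].
apply: spanned_gen; exists a, (sub0 _), << idm a >>, f; split=> //.
  by move=> c g g' /eqP; rewrite subr_eq0 => /eqP->.
by rewrite /= reprF_mapU mcompm1.
Qed.

Lemma finitely_generated_in_Fpred F :
  (forall a, exists n, ~ chain n (sub0 (hom_rep a)) (subT (hom_rep a))) ->
  finitely_generated F -> exists d, in_Fpred d.+1 F.
Proof.
move=> bd [s [p p_surj]].
suff [n gn] : exists n,
    colength_gens n (foldr (fun a => sumF (reprF k a)) (zeroF k A) s).
  (* The bound [n] is weakened to [n.+1], because [in_Fpred d.+1] stands for degree at most [d]. *)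
  exists n; apply/colength_gens_in_Fpred/(colength_gens_leq (leqnSn n)).
  by move=> b v; have [w <-] := p_surj b v; apply: colength_gens_image.
elim: s {p p_surj} => [|a s [n gn]] /=.
  by exists 0%N; apply: colength_gens_zeroF.
have [m nch] := bd a; exists (maxn m n); apply: colength_gens_sumF.
  exact: colength_gens_leq (leq_maxl m n) (colength_gens_reprF nch).
exact: colength_gens_leq (leq_maxr m n) gn.
Qed.

(** * Lower bound on the degree, by duality *)

Definition invariant_fun a (I : subrep (hom_rep a)) b (t : hom a b -> k) : Prop :=
  forall f g : hom_rep a b, I b (f - g) -> t f = t g.

(* The transpose of an epimorphism [F -> k[A(a,-)/I]]: a function [t] on
   [A(a,b)/I(b)] is a linear form on [k[A(a,b)/I(b)]], pulled back to [F b]. *)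
Record detection F a (I : subrep (hom_rep a)) := Detection {
  form : forall b, (hom a b -> k) -> F b -> k;
  form_linear : forall b (t : hom a b -> k),
    invariant_fun I t -> linear (form t : F b -> k^o);
  form0 : forall b w, form (fun _ : hom a b => 0) w = 0;
  form_nat : forall b c (g : hom b c) (t : hom a c -> k) w,
    invariant_fun I t -> form t (kmap F g w) = form (fun f => t (g ∘ f)) w;
  form_dual : forall b (h : hom a b), exists w, forall t,
    invariant_fun I t -> form t w = t h
}.

(** The constant function 1 is invariant under any [I], and its form takes the value 1 on an element
    dual to [idm a]. *)
Lemma detection_nonzero F a (I : subrep (hom_rep a)) : detection F I -> ~ kzero F.
Proof.
move=> lam F0; have [w dual] := form_dual lam (idm a).
have inv1 : invariant_fun I (fun _ : hom a a => 1) by [].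
have /eqP := dual _ inv1; rewrite (F0 _ w) (linear_pred0 (form_linear lam inv1)).
by rewrite eq_sym oner_eq0.
Qed.

Lemma invariant_fun_comp a (I : subrep (hom_rep a)) b c (g : hom b c) t :
  invariant_fun I t -> invariant_fun I (fun f : hom a b => t (g ∘ f)).
Proof.
by move=> It f f' /(subrep_map g) Iff; apply: It; rewrite -raddfB.
Qed.

Lemma detection_reprF a : detection (reprF k a) (sub0 (hom_rep a)).
Proof.
exists (fun b t w => fglift (t : hom a b -> k^o) w)
  => [b t _|b w|b c g t w _|b h].
- exact: fglift_is_linear.
- apply: (linear_eq_spanned (W := k^o) (g := fun=> 0)
    (f := fun w : {freeg (hom a b) / k} => fglift (fun=> 0 : k^o) w))
    (freeg_spanned w).
  + exact: fglift_is_linear.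
  + by move=> c u v; rewrite scaler0 addr0.
  by move=> _ [f ->]; rewrite liftU scaler0.
- apply: (linear_eq_spanned (W := k^o)
    (f := fun w : {freeg (hom a b) / k} =>
            fglift (t : hom a c -> k^o) (kmap (reprF k a) g w))) (freeg_spanned w).
  + by move=> z u v; rewrite linearP fglift_is_linear.
  + exact: fglift_is_linear.
  by move=> _ [f ->]; rewrite /= reprF_mapU !liftU.
by exists << h >> => t _; rewrite liftU scale1r.
Qed.

(** The projections [prr x b] induce an epimorphism from [tau x F] to [F], split by the inclusions
    [injr x b]; the forms are pulled back along it. *)
Lemma detection_tau x F a (I : subrep (hom_rep a)) :
  detection F I -> detection (tau x F) I.
Proof.
move=> lam.
exists (fun b t (w : tau x F b) => form lam (fun h => t (prr x b ∘ h)) w)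
  => [b t It|b w|b c g t w It|b h].
- exact: (form_linear lam (invariant_fun_comp (prr x b) It)).
- exact: form0.
- rewrite form_nat; last exact: invariant_fun_comp.
  by congr form; apply/funext => h; rewrite !mcompA prr_idsum.
have [w dual] := form_dual lam (injr x b ∘ h); exists w => t It.
by rewrite dual; [rewrite mcompA prr_injr mcomp1m | apply: invariant_fun_comp].
Qed.

Section DetectionDelta.
Variables (F : kfunctor k A) (a x : A) (I : subrep (hom_rep a)).
Variables (lam : detection F I) (f : hom_rep a x) (nIf : ~ I x f).

(* [t] extended by zero from the summand of [delta_bar_x k[A(a,-)/I]] indexed by
   [f]. *)
Definition extend_fun b (t : hom a b -> k) (h : hom a (x ⊕ b)) : k :=
  if `[< I x (prl x b ∘ h - f) >] then t (prr x b ∘ h) else 0.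

Lemma extend_fun_invariant b (t : hom a b -> k) :
  invariant_fun (adjoin I f) t -> invariant_fun I (extend_fun t).
Proof.
move=> It h h' Ihh; rewrite /extend_fun.
have Il : I x (prl x b ∘ h - prl x b ∘ h' : hom_rep a x).
  by have := subrep_map (prl x b) Ihh; rewrite raddfB.
have -> : `[< I x (prl x b ∘ h - f) >] = `[< I x (prl x b ∘ h' - f) >].
  apply: asbool_equiv_eq; split=> Ih.
    by have := subrepB Ih Il; rewrite opprB addrC addrA subrK.
  by have := subrepD Il Ih; rewrite addrA subrK.
case: ifP => // _; apply: It; apply: sub_le_adjoin.
by have := subrep_map (prr x b) Ihh; rewrite raddfB.
Qed.

(** The kernel has two sources. On elements from [F b] the component in [x] is 0, not congruent to
    [f] modulo [I], so the extension vanishes. On a coinvariance relation, a transvection moves the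
    second component by some [u ∘ f] modulo [I], to which [t] is insensitive. *)
Lemma form_extend_ker b (t : hom a b -> k) (w : F (x ⊕ b)) :
  invariant_fun (adjoin I f) t -> delta_proj w = 0 ->
  form lam (extend_fun t) w = 0.
Proof.
move=> It; have It' := extend_fun_invariant It.
have lin := form_linear lam It'.
move=> /delta_proj_ker[w0 Sw]; rewrite -(subrK (kmap F (injr x b) w0) w).
rewrite -[_ - _]scale1r lin scale1r form_nat //.
rewrite [X in form lam X w0](_ : _ = fun=> 0) ?form0 ?addr0; last first.
  apply/funext => h; rewrite /extend_fun mcompA prl_injr mcomp0m sub0r.
  case: asboolP => // /subrepN; rewrite opprK => /nIf; exact: False_rect.
apply: (linear_eq_spanned (W := k^o) (g := fun=> 0)) Sw; first exact: lin.
  by move=> c u v; rewrite scaler0 addr0.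
move=> _ [u [v ->]].
have linB v1 v2 : form lam (extend_fun t) (v1 - v2) =
    form lam (extend_fun t) v1 - form lam (extend_fun t) v2.
  by rewrite addrC -scaleN1r lin scaleN1r addrC.
rewrite linB form_nat //; apply/eqP; rewrite subr_eq0; apply/eqP.
congr form; apply/funext => h; rewrite /extend_fun mcompA prl_transvection.
case: asboolP => // Ih; rewrite mcompA prr_transvection; apply: It.
by exists u; rewrite mcompDl addrK -mcompA -raddfB; apply: (subrep_map u Ih).
Qed.

Lemma detection_delta : detection (delta_bar x F) (adjoin I f).
Proof.
(* One [repr] for each of the two quotients; [lamE] shows that for invariant [t] the choice does not
   matter. *)
pose lam' b (t : hom a b -> k) (v : delta_bar x F b) : k :=
  form lam (extend_fun t) (repr (repr v)).
have lamE b (t : hom a b -> k) (w : F (x ⊕ b)) : invariant_fun (adjoin I f) t ->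
    lam' b t (delta_proj w) = form lam (extend_fun t) w.
  move=> It; have lin := form_linear lam (extend_fun_invariant It).
  have := @form_extend_ker b t (- w + repr (repr (delta_proj w))) It.
  rewrite -scaleN1r lin linearP /= {2}/delta_proj /= !qproj_repr !scaleN1r.
  by rewrite addNr => /(_ erefl)/eqP; rewrite addrC subr_eq0 => /eqP.
exists lam' => [b t It c u v|b w|b c g t v It|b h].
- have [u' <-] := delta_proj_surj u; have [v' <-] := delta_proj_surj v.
  by rewrite -linearP !lamE // (form_linear lam (extend_fun_invariant It)).
- rewrite /lam' (_ : extend_fun _ = fun=> 0) ?form0 //.
  by apply/funext => h; rewrite /extend_fun if_same.
- have [w <-] := delta_proj_surj v.
  rewrite -delta_proj_nat !lamE //; last exact: invariant_fun_comp.
  rewrite form_nat; last exact: extend_fun_invariant.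
  congr form; apply/funext => h.
  by rewrite /extend_fun !mcompA prl_idsum prr_idsum.
(* With first component exactly [f], the extension of [t] takes the value [t h] on this pairing. *)
have [w dual] := form_dual lam (pairing f h); exists (delta_proj w) => t It.
rewrite lamE // dual; last exact: extend_fun_invariant.
rewrite /extend_fun prl_pairing prr_pairing subrr.
by case: asboolP => // -[]; apply: subrep0.
Qed.

End DetectionDelta.

(** Along a chain, applying [delta_bar] at the object of each adjoined element carries a detection
    to the next subobject; the one left at the end contradicts vanishing. *)
Lemma detection_no_chain n F a (I : subrep (hom_rep a)) : detection F I ->
  (forall s, size s = n -> kzero (foldr (@delta_bar k A) F s)) ->
  ~ chain n I (subT (hom_rep a)).
Proof.
elim: n F I => [|n IHn] F I lam zeroF ch.
  exact: detection_nonzero lam (zeroF [::] erefl).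
have [x [f [_ nIf ch']]] := ch.
apply: (IHn _ _ (detection_delta lam nIf)) ch' => s sz.
(* The first step of the chain gives the innermost [delta_bar], so [x] goes to the end of the
   list. *)
by rewrite -foldr_rcons; apply: zeroF; rewrite size_rcons sz.
Qed.

Lemma reprF_finitely_generated a : finitely_generated (reprF k a).
Proof.
exists [:: a].
exists (@KNat k A (sumF (reprF k a) (zeroF k A)) (reprF k a)
  (fun b => fst) (fun _ _ _ _ => erefl)) => b v.
by exists (v, 0).
Qed.

End Functors.

Theorem mainTheorem12 (k : fieldType) (A : additiveCategory)
    (hA : essentially_small A) :
  (forall F : kfunctor k A,
     finitely_generated F -> exists d : nat, in_Fpred d.+1 F) <->
  locally_finite A.
Proof.
split=> [fg|/locally_finiteP bd F]; last exact: finitely_generated_in_Fpred.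
apply/locally_finiteP => a.
have [d Fd] := fg _ (reprF_finitely_generated k a).
(* Vanishing is only known after some [tau]; the choice of [a] as its object is arbitrary. *)
exists d.+1; apply: (detection_no_chain (detection_tau a (detection_reprF k a))).
by move=> s; apply: Fd.
Qed.
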